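(* Let $\eta>0$, $\gamma>0$, $0\le\alpha\le 1$, $s\in\mathbb{N}\cup\{0\}$ and $\phi\in C[0,1]$. Then $$\lim_{m\to\infty}\Re_{m,\eta,\gamma}^{(\alpha,s)}(\phi;z)=\phi(z)$$ uniformly in $z\in[0,1]$.
   Context: $\mathbb{N}$ denotes the positive integers, and $C[0,1]$ the real-valued continuous functions on $[0,1]$. Binomial coefficients are $\binom{a}{b}=\frac{a!}{b!(a-b)!}$ if $0\le b\le a$ and $0$ otherwise; a term whose binomial coefficient is $0$ is understood to be $0$, and $0^0=1$. For $m\in\mathbb{N}$, $0\le j\le m$, $0\le\alpha\le1$, $s\in\mathbb{N}\cup\{0\}$ and $z\in[0,1]$ put: if $m<s$, $$q_{m,j}^{(\alpha,s)}(z)=\binom{m}{j}z^j(1-z)^{m-j};$$ if $m\ge s$, $$q_{m,j}^{(\alpha,s)}(z)=(1-\alpha)\binom{m-s}{j-s}z^{j-s+1}(1-z)^{m-j}+(1-\alpha)\binom{m-s}{j}z^{j}(1-z)^{m-s-j+1}+\alpha\binom{m}{j}z^j(1-z)^{m-j}.$$ For $\eta>0$, $\gamma>0$ and $\phi\in C[0,1]$ define, with $\Gamma$ the Gamma function, $$\Re_{m,\eta,\gamma}^{(\alpha,s)}(\phi;z)=\Gamma(\eta+1)\sum_{j=0}^{m}q_{m,j}^{(\alpha,s)}(z)\int_0^1\frac{(1-t)^{\eta-1}}{\Gamma(\eta)}\,\phi\!\left(\frac{j+t^{\gamma}}{m+1}\right)dt .$$ *)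

(* Defs.v *)
From HB Require Import structures.
From mathcomp Require Import all_boot all_order all_algebra.
From mathcomp Require Import all_classical all_reals all_analysis.

Set Implicit Arguments.
Unset Strict Implicit.
Unset Printing Implicit Defensive.

Import Order.TTheory GRing.Theory Num.Theory.
Import numFieldNormedType.Exports.

Local Open Scope classical_set_scope.
Local Open Scope ring_scope.

(* Euler's integral; used only for a > 0, where the integrand is Lebesgue
   integrable. *)
Definition Gamma (R : realType) (a : R) : R :=
  (\int[lebesgue_measure]_(t in `]0, +oo[) (t `^ (a - 1) * expR (- t)))%R.

(* The test s <= j makes binom(m - s, j - s) vanish for j < s, where the
   truncated difference j - s would give binom(m - s, 0) = 1.  In the second
   term the exponent m - s - j + 1 is truncated only for j > m - s, where the
   binomial coefficient is 0. *)
Definition qbasis (R : realType) (alpha : R) (s m j : nat) (z : R) : R :=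
  if (m < s)%N then 'C(m, j)%:R * z ^+ j * (1 - z) ^+ (m - j)
  else
    (1 - alpha) * (if (s <= j)%N then 'C(m - s, j - s) else 0%N)%:R
      * z ^+ (j - s + 1) * (1 - z) ^+ (m - j)
    + (1 - alpha) * 'C(m - s, j)%:R * z ^+ j * (1 - z) ^+ (m - s - j + 1)
    + alpha * 'C(m, j)%:R * z ^+ j * (1 - z) ^+ (m - j).

Definition frac_kantorovich (R : realType) (eta gamma alpha : R) (s m : nat)
    (phi : R -> R) (z : R) : R :=
  Gamma (eta + 1) *
  \sum_(0 <= j < m.+1) qbasis alpha s m j z *
    (\int[lebesgue_measure]_(t in `[0, 1])
       ((1 - t) `^ (eta - 1) / Gamma eta
        * phi ((j%:R + t `^ gamma) / (m%:R + 1))))%R.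

(* Main.v *)
Require Import Defs.
From mathcomp Require Import all_boot all_order all_algebra.
From mathcomp Require Import all_classical all_reals all_analysis.
From mathcomp Require Import measurable_realfun ring lra.

Import Order.TTheory GRing.Theory Num.Theory.
Import numFieldNormedType.Exports.

Local Open Scope classical_set_scope.
Local Open Scope ring_scope.

(* The weights are normalised because Gamma (eta + 1) = eta * Gamma eta
   (integration by parts on [1 / n, n] and monotone convergence) and the
   integral of (1 - t)^(eta - 1) over [0, 1] is 1 / eta, so the operator
   averages phi over the nodes (j + t^gamma) / (m + 1).  For m >= s the qbasis
   is a convex combination of Bernstein bases of degrees m - s and m, which
   bounds its second moment about m z by m + s^2; hence the mean square
   distance of the nodes from z is O(1 / m) uniformly in z.  Uniform continuity
   is used in the form |phi x - phi y| <= e + C (x - y)^2. *)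

(** * Bernstein sums and the moments of [qbasis] *)

(** The nodes are the integers [j] rather than [j / n], so that a shift of the index is plain
    composition with [S]. *)
Definition bernstein {R : pzRingType} (n : nat) (f : nat -> R) (z : R) : R :=
  \sum_(0 <= j < n.+1) 'C(n, j)%:R * z ^+ j * (1 - z) ^+ (n - j) * f j.

(** Pascal's rule; in probabilistic terms, conditioning on one of n + 1 independent trials with
    success probability z. *)
Lemma bernsteinS {R : comPzRingType} (n : nat) (f : nat -> R) (z : R) :
  bernstein n.+1 f z =
  z * bernstein n (f \o S) z + (1 - z) * bernstein n f z.
Proof.
have -> : bernstein n f z =
    \sum_(0 <= j < n.+2) 'C(n, j)%:R * z ^+ j * (1 - z) ^+ (n - j) * f j.
  by rewrite [RHS]big_nat_recr//= bin_small// !mul0r addr0.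
rewrite /bernstein big_nat_recl// [X in _ + _ * X]big_nat_recl//= mulrDr addrCA.
rewrite !mulr_sumr -big_split/=; congr (_ + _).
  by rewrite !bin0 !subn0 exprS; ring.
rewrite big_nat [RHS]big_nat; apply: eq_bigr => j /andP[_ jn].
rewrite binS natrD subSS exprS ![in LHS]mulrDl [LHS]addrC; congr (_ + _); first by ring.
(* For j = n the truncated exponent [n - j.+1] is 0 and no factor 1 - z can be split off, but the
   binomial coefficient vanishes. *)
have [->|jn'] := eqVneq j n; first by rewrite bin_small// !mul0r mulr0.
have {}jn : (j < n)%N by rewrite ltn_neqAle jn' -ltnS.
by rewrite -[in LHS](subnSK jn) exprS; ring.
Qed.

Lemma bernstein1 {R : comPzRingType} (n : nat) (z : R) :
  bernstein n (fun=> 1) z = 1.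
Proof.
elim: n => [|n IH]; last by rewrite bernsteinS [_ \o _](_ : _ = fun=> 1)// IH; ring.
by rewrite /bernstein big_nat1 bin0 !expr0 !mulr1.
Qed.

(** Variance plus squared bias of the binomial law. The centre c stays arbitrary because the shift
    in the recursion turns c into c - 1. *)
Lemma bernstein_sqr {R : comPzRingType} (n : nat) (c z : R) :
  bernstein n (fun j => (j%:R - c) ^+ 2) z =
  n%:R * z * (1 - z) + (n%:R * z - c) ^+ 2.
Proof.
elim: n c => [|n IH] c.
  by rewrite /bernstein big_nat1 bin0 !expr0; ring.
rewrite bernsteinS IH.
rewrite [_ \o _](_ : _ = fun j : nat => (j%:R - (c - 1)) ^+ 2); last first.
  by apply/funext => j /=; rewrite -natr1; ring.
by rewrite IH -natr1; ring.
Qed.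

(** With weight 1 - alpha, a Bernstein sum of degree m - s, whose index is shifted by s with weight
    z and left alone with weight 1 - z; with weight alpha, the ordinary sum of degree m. All moments
    of [qbasis] are read off from this. *)
Lemma sum_qbasis {R : realType} (alpha : R) (s m : nat) (f : nat -> R) (z : R) :
  (s <= m)%N ->
  \sum_(0 <= j < m.+1) qbasis alpha s m j z * f j =
  (1 - alpha) * (z * bernstein (m - s) (fun i => f (i + s)%N) z
                 + (1 - z) * bernstein (m - s) f z)
  + alpha * bernstein m f z.
Proof.
move=> sm; rewrite /qbasis ltnNge sm/=; move: (1 - alpha) => a.
under eq_bigr do rewrite !mulrDl.
rewrite !big_split/= mulrDr /bernstein; congr (_ + _ + _).
- rewrite (big_cat_nat (n := s))//=; last by rewrite ltnW.
  rewrite big_nat big1 ?add0r; last first.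
    by move=> j /andP[_ js]; rewrite leqNgt js/= mulr0 !mul0r.
  rewrite -{1}[s]add0n big_addn !mulr_sumr subSn//.
  rewrite big_nat [RHS]big_nat; apply: eq_bigr => j /andP[_ jn].
  by rewrite leq_addl addnK addn1 exprS (addnC j) subnDA; ring.
- rewrite (big_cat_nat (n := (m - s).+1))//=; last by rewrite ltnS leq_subr.
  rewrite [X in _ + X]big_nat [X in _ + X]big1 ?addr0; last first.
    by move=> j /andP[js _]; rewrite bin_small// mulr0 !mul0r.
  rewrite !mulr_sumr; apply: eq_bigr => j _.
  by rewrite addn1 exprS; ring.
- by rewrite mulr_sumr; apply: eq_bigr => j _; ring.
Qed.

Lemma qbasis_ge0 {R : realType} (alpha : R) (s m j : nat) (z : R) :
  0 <= alpha <= 1 -> 0 <= z <= 1 -> 0 <= qbasis alpha s m j z.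
Proof.
move=> /andP[a0 a1] /andP[z0 z1]; rewrite /qbasis.
have a1' : 0 <= 1 - alpha by rewrite subr_ge0.
have z1' : 0 <= 1 - z by rewrite subr_ge0.
by case: ifP => _; rewrite ?addr_ge0// !mulr_ge0// ?exprn_ge0.
Qed.

Lemma sum_qbasis1 {R : realType} (alpha : R) (s m : nat) (z : R) :
  (s <= m)%N -> \sum_(0 <= j < m.+1) qbasis alpha s m j z = 1.
Proof.
move=> sm; under eq_bigr do rewrite -[qbasis _ _ _ _ _]mulr1.
by rewrite (sum_qbasis alpha s m (fun=> 1))// !bernstein1; ring.
Qed.

(** The exact value is (m - (1 - alpha) s + (1 - alpha) s^2) z (1 - z), and 0 <= z (1 - z) <= 1. *)
Lemma sum_qbasis_sqr_le {R : realType} (alpha : R) (s m : nat) (z : R) :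
  0 <= alpha <= 1 -> 0 <= z <= 1 -> (s <= m)%N ->
  \sum_(0 <= j < m.+1) qbasis alpha s m j z * (j%:R - m%:R * z) ^+ 2 <=
  m%:R + s%:R ^+ 2.
Proof.
move=> /andP[a0 a1] /andP[z0 z1] sm.
rewrite (sum_qbasis alpha s m (fun j => (j%:R - m%:R * z) ^+ 2))//.
rewrite (_ : (fun i => _) = fun i : nat => (i%:R - (m%:R * z - s%:R)) ^+ 2); last first.
  by apply/funext => i; rewrite natrD; ring.
rewrite !bernstein_sqr natrB//.
have sm' : s%:R <= m%:R :> R by rewrite ler_nat.
have s0 : 0 <= s%:R :> R by [].
set M : R := m%:R in sm' *; set S : R := s%:R in sm' s0 *.
have zz : 0 <= z * (1 - z) <= 1 by apply/andP; split; nra.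
have {zz} [zz0 zz1] := andP zz.
rewrite [leLHS](_ : _ = (M - (1 - alpha) * S) * (z * (1 - z))
  + (1 - alpha) * S ^+ 2 * (z * (1 - z))); last by ring.
apply: lerD.
  have aS : 0 <= (1 - alpha) * S by rewrite mulr_ge0// subr_ge0.
  have aSS : (1 - alpha) * S <= S by rewrite ler_piMl//; lra.
  rewrite (le_trans (ler_piMr _ zz1))//; lra.
rewrite (le_trans (ler_piMr _ zz1))//.
  by rewrite mulr_ge0// ?subr_ge0// sqr_ge0.
by rewrite ler_piMl ?sqr_ge0//; lra.
Qed.

(** * Uniform continuity and uniform convergence *)

(** For close points continuity gives the bound e; for distant ones the quadratic term exceeds twice
    the supremum of |phi|. In this form the estimate can be averaged using second moments alone. *)
Lemma continuous_le_sqr {R : realType} (a b : R) (phi : R -> R) (e : R) :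
  {within `[a, b], continuous phi} -> 0 < e ->
  exists2 C : R, 0 <= C & forall x y : R, x \in `[a, b] -> y \in `[a, b] ->
    `|phi x - phi y| <= e + C * (x - y) ^+ 2.
Proof.
move=> cphi e0.
have [M M0 phiM] : exists2 M : R, 0 < M & forall x, x \in `[a, b] -> `|phi x| <= M.
  have /compact_bounded[N [_ HN]] :
    compact (phi @` `[a, b]) by apply: continuous_compact => //; exact: segment_compact.
  exists (Num.max 1 (N + 1)); first by rewrite lt_max ltr01.
  move=> x xab; apply: HN; last by exists x.
  by rewrite lt_max [X in _ || X]ltrDl ltr01 orbT.
(* Compactness reduces the claim to a local one: near each x, all large C must work. *)
have /compact_near_coveringP/near_covering_withinP := @segment_compact R a b.
move=> /(_ _ (pinfty_nbhs R) (fun C x => forall y, y \in `[a, b] ->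
    `|phi x - phi y| <= e + C * (x - y) ^+ 2)) H.
suff {H}/H near_C : forall x, [set` `[a, b]] x -> \forall x' \near x & C \near +oo,
    [set` `[a, b]] x' -> forall y, y \in `[a, b] ->
    `|phi x' - phi y| <= e + C * (x' - y) ^+ 2.
  near (pinfty_nbhs R) => C; exists C; first by near: C; exact: nbhs_pinfty_ge.
  move=> x y xab yab; apply: (near near_C C) => //.
move=> x xab.
have /subspace_continuousP/(_ x xab)/cvgrPdist_lt/(_ (e / 2)) := cphi.
rewrite divr_gt0// => /(_ isT) /nbhs_ballP[d /= d0 xd].
(* If |x - y| >= d and |x - x'| < d / 2, then (x' - y)^2 >= d^2 / 4, so C >= 8 M / d^2 makes C (x' -
   y)^2 at least 2 M. *)
exists (ball x (d / 2), [set C | 8 * M / d ^+ 2 <= C]) => /=.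
  split; first by apply: nbhsx_ballx; rewrite divr_gt0.
  by apply: nbhs_pinfty_ge; rewrite num_real.
move=> [x' C]/= [xx' CM] x'ab y yab.
have C0 : 0 <= C.
  by apply: le_trans CM; rewrite divr_ge0 ?mulr_ge0 ?sqr_ge0// ltW.
have [xy|xy] := ltP `|x - y| d.
  have := xd _ xy yab; have : ball x d x'.
    by apply: le_ball xx'; lra.
  move=> /xd/(_ x'ab) h1 h2.
  have -> : phi x' - phi y = (phi x - phi y) - (phi x - phi x') by ring.
  rewrite (le_trans (ler_normB _ _))// -[leLHS]addr0 lerD//.
    by rewrite [leRHS](splitr e) lerD// ltW.
  by rewrite mulr_ge0// sqr_ge0.
have x'y : d / 2 <= `|x' - y|.
  have : `|x - y| <= `|x - x'| + `|x' - y| by exact: ler_distD.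
  by move: xx'; rewrite /ball/= => xx'; lra.
rewrite (le_trans (ler_normB _ _))// (@le_trans _ _ (2 * M))//.
  by rewrite mulr2n mulrDl mul1r lerD// phiM.
rewrite (@le_trans _ _ (C * (x' - y) ^+ 2))//; last by rewrite lerDr ltW.
have -> : 2 * M = 8 * M / d ^+ 2 * (d / 2) ^+ 2.
  by field; rewrite gt_eqF.
apply: ler_pM => //; rewrite ?sqr_ge0//.
  by rewrite divr_ge0 ?mulr_ge0 ?sqr_ge0// ltW.
by rewrite -[leRHS]real_normK ?num_real// lerXn2r// nnegrE ?divr_ge0// ltW.
Unshelve. all: by end_near. Qed.

Lemma cvg_uniform_norm {T : choiceType} {R : realType} (A : set T)
    (f : nat -> T -> R) (g : T -> R) :
  (forall e, 0 < e -> \forall n \near \oo, forall x, A x -> `|g x - f n x| <= e) ->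
  {uniform A, f @ \oo --> g}.
Proof.
move=> H P /uniform_nbhs[E [entE EP]].
have [/= e e0 eE] : entourage_ (@ball R R) E by rewrite entourage_ballE.
have e2 : 0 < e / 2 by rewrite divr_gt0.
apply: filterS (H _ e2) => n fn.
apply: EP => x Ax; apply: eE => /=.
rewrite /ball/=; apply: le_lt_trans (fn _ Ax) _.
by rewrite ltr_pdivrMr// ltr_pMr// ltr1n.
Qed.

(** * The integral of (1 - t)^(p - 1) over [0, 1] *)

Lemma is_derive_onem_powR {R : realType} (p x : R) : x < 1 ->
  is_derive x 1 (fun t => (1 - t) `^ p) (- p * (1 - x) `^ (p - 1)).
Proof.
move=> x1; have x1' : 0 < 1 - x by rewrite subr_gt0.
have d1 : is_derive x 1 (fun t : R => 1 - t) (-1).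
  by apply: is_derive_eq; ring.
have := @is_derive1_comp R (fun u => u `^ p) (fun t => 1 - t) x _ _
  (is_derive1_powR p x1') d1.
by move=> /is_derive_eq; apply; ring.
Qed.

Lemma derivable1_continuous {R : realType} (f : R -> R) (x : R) :
  derivable f x 1 -> {for x, continuous f}.
Proof. by move=> /derivable1_diffP/differentiable_continuous. Qed.

Lemma measurable_onem_powR {R : realType} (p : R) (D : set R) :
  measurable_fun D (fun t => (1 - t) `^ p).
Proof.
apply/measurable_funTS.
have mB : measurable_fun setT (fun t : R => 1 - t) by exact: measurable_funB.
exact: (@measurableT_comp _ _ _ R R R (fun x => x `^ p) setT
  (fun t => 1 - t) (measurable_powR _) mB).
Qed.

(** For p < 1 the integrand is unbounded near 1, so the fundamental theorem of calculus is applied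
    on [0, 1 - 1 / (n + 2)] and monotone convergence gives the limit. The extended-real statement
    also yields integrability. *)
Lemma integral_onem_powR {R : realType} (p : R) : 0 < p ->
  (\int[lebesgue_measure]_(t in `[0%R, 1%R]) ((1 - t) `^ (p - 1))%:E = (p^-1)%:E)%E.
Proof.
move=> p0.
have mf (D : set R) : measurable_fun D (EFin \o (fun t : R => (1 - t) `^ (p - 1))).
  by apply/measurable_EFinP; exact: measurable_onem_powR.
rewrite -integral_itv_bndo_bndc; last exact: mf.
pose a n : R := 1 - n.+2%:R^-1.
have a01 n : 0 < a n < 1.
  rewrite /a subr_gt0 invf_lt1// ltr1n/= gtrBl invr_gt0//.
have -> : `[0%R, 1%R[%classic = \bigcup_n `[0%R, a n]%classic.
  apply/seteqP; split => [x|x [n _]]/=; rewrite !in_itv/= => /andP[x0 x1].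
    have [n xn] : exists n, (1 - x)^-1 < n.+2%:R.
      exists (Num.truncn (1 - x)^-1).
      by rewrite (lt_trans (truncnS_gt _))// ltr_nat.
    exists n => //=; rewrite in_itv/= x0/= /a lerBrDr -lerBrDl.
    by rewrite invf_ple ?posrE ?subr_gt0// ltW.
  by rewrite x0 (le_lt_trans x1)//; case/andP: (a01 n).
have nda : nondecreasing_seq (fun n => `[0%R, a n]%classic).
  move=> m n mn; rewrite subsetEset => x/=; rewrite !in_itv/=.
  move=> /andP[-> /le_trans->]//.
  by rewrite /a lerB// lef_pV2 ?posrE// ler_nat.
have : (\int[lebesgue_measure]_(t in `[0%R, a n]) ((1 - t) `^ (p - 1))%:E
    @[n --> \oo] -->
    \int[lebesgue_measure]_(t in \bigcup_n `[0%R, a n]%classic)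
      ((1 - t) `^ (p - 1))%:E)%E.
  apply: ge0_nondecreasing_set_cvg_integral => //.
  - by move=> i; exact: mf.
  - by move=> i x _; rewrite lee_fin powR_ge0.
move=> /cvg_lim <- //; apply/cvg_lim => //.
have F n : (\int[lebesgue_measure]_(t in `[0%R, a n]) ((1 - t) `^ (p - 1))%:E =
    (p^-1 - p^-1 * (1 - a n) `^ p)%:E)%E.
  have [a0 a1] := andP (a01 n).
  have dF (x : R) : x < 1 ->
      is_derive x 1 (fun t => - p^-1 * (1 - t) `^ p) ((1 - x) `^ (p - 1)).
    move=> x1; have h := is_derive_onem_powR p x x1.
    have := is_deriveZ (- p^-1) h.
    by move=> /is_derive_eq; apply; rewrite /GRing.scale/=; field; rewrite gt_eqF.
  have cF (x : R) : x < 1 -> {for x, continuous (fun t : R => - p^-1 * (1 - t) `^ p)}.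
    by move=> /dF ?; apply: derivable1_continuous; exact: ex_derive.
  rewrite (@continuous_FTC2 _ _ (fun t => - p^-1 * (1 - t) `^ p))//.
  - by rewrite -EFinB; congr EFin; rewrite subr0 powR1; ring.
  - apply: derivable_within_continuous => x; rewrite in_itv/= => /andP[_ xa].
    by have := is_derive_onem_powR (p - 1) x (le_lt_trans xa a1) => ?; exact: ex_derive.
  - split.
    + move=> x; rewrite in_itv/= => /andP[_ xa].
      by have := dF x (lt_trans xa a1) => ?; exact: ex_derive.
    + exact/cvg_at_right_filter/cF.
    + exact/cvg_at_left_filter/cF.
  - move=> x; rewrite in_itv/= => /andP[_ xa].
    by rewrite derive1E; have := dF x (lt_trans xa a1) => ?; exact: derive_val.
under eq_fun do rewrite F.
apply: cvg_EFin; first by near=> n.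
rewrite -[X in _ --> X]subr0 -[X in _ --> _ - X](mulr0 p^-1).
apply: cvgB; first exact: cvg_cst.
apply: cvgMr.
have /cvg_at_rightP := powR_cvg0 p0; apply; split=> [n|].
  by rewrite /a subKr invr_gt0.
rewrite (_ : (fun n => _) = fun n => harmonic n.+1); last first.
  by apply/funext => n; rewrite /a subKr.
have /= := cvg_shiftS (@harmonic R) (nbhs (0 : R)).
by move=> ->; exact: cvg_harmonic.
Unshelve. all: by end_near. Qed.

Lemma integrable_onem_powR {R : realType} (p : R) : 0 < p ->
  lebesgue_measure.-integrable `[0, 1] (EFin \o (fun t : R => (1 - t) `^ (p - 1))).
Proof.
move=> p0; apply/integrableP; split.
  by apply/measurable_EFinP; exact: measurable_onem_powR.
under eq_integral do rewrite /= ger0_norm ?powR_ge0//.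
by rewrite integral_onem_powR// ltry.
Qed.

(** * The Gamma function: finiteness, functional equation, positivity *)

(* Exponent p, not p - 1: its integral is Gamma (p + 1). *)
Definition gamma_integrand {R : realType} (p t : R) : R := t `^ p * expR (- t).

Lemma gamma_integrand_ge0 {R : realType} (p t : R) : 0 <= gamma_integrand p t.
Proof. by rewrite mulr_ge0 ?powR_ge0 ?expR_ge0. Qed.

Lemma measurable_gamma_integrand {R : realType} (p : R) (D : set R) :
  measurable_fun D (EFin \o gamma_integrand p).
Proof.
apply/measurable_EFinP/measurable_funTS/measurable_funM.
  exact: measurable_powR.
by apply: measurableT_comp => //; exact: measurable_expR.
Qed.

(** The inequality x <= exp x at x = t / (2 p), raised to the power p. *)
Lemma powR_le_expR {R : realType} (p t : R) : 0 < p -> 0 <= t ->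
  t `^ p <= (2 * p) `^ p * expR (t / 2).
Proof.
move=> p0 t0; have p20 : 0 < 2 * p by rewrite mulr_gt0.
have [p0' p20'] := (ltW p0, ltW p20).
have {1}-> : t = 2 * p * (t / (2 * p)) by field; rewrite gt_eqF.
rewrite powRM ?divr_ge0//.
rewrite ler_wpM2l ?powR_ge0//.
have -> : expR (t / 2) = expR (t / (2 * p)) `^ p.
  by rewrite -expRM; congr expR; field; rewrite gt_eqF.
rewrite ge0_ler_powR ?nnegrE ?divr_ge0 ?expR_ge0//.
by rewrite (le_trans _ (expR_ge1Dx _))// lerDr.
Qed.

Lemma gamma_integrand_le {R : realType} (p t : R) : 0 < p -> 0 <= t ->
  gamma_integrand p t <= (2 * p) `^ p * expR (- (t / 2)).
Proof.
move=> p0 t0; rewrite /gamma_integrand.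
have -> : expR (- (t / 2)) = expR (t / 2) * expR (- t).
  by rewrite -expRD; congr expR; field.
by rewrite mulrA ler_wpM2r ?expR_ge0// powR_le_expR.
Qed.

(** Domination by a multiple of the exponential density of rate 1/2; the factor 2 in [K] cancels
    that rate. *)
Lemma integral_gamma_integrand_lty {R : realType} (p : R) : 0 < p ->
  (\int[lebesgue_measure]_(t in `]0%R, +oo[) (gamma_integrand p t)%:E < +oo)%E.
Proof.
move=> p0; pose K : R := 2 * (2 * p) `^ p.
have K0 : 0 <= K by rewrite mulr_ge0 ?powR_ge0.
have r0 : 0 < 2^-1 :> R by rewrite invr_gt0.
have mpdf : measurable_fun setT (EFin \o exponential_pdf (2^-1 : R)).
  by apply/measurable_EFinP; exact: measurable_exponential_pdf.
apply: (@le_lt_trans _ _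
    (\int[lebesgue_measure]_(t in `]0%R, +oo[) (K%:E * (exponential_pdf 2^-1 t)%:E)))%E.
  apply: ge0_le_integral => //=.
  - by move=> t _; rewrite lee_fin gamma_integrand_ge0.
  - exact: measurable_gamma_integrand.
  - by apply/measurable_funeM/measurable_funTS.
  - move=> t; rewrite in_itv/= andbT => t0.
    rewrite -EFinM lee_fin (le_trans (gamma_integrand_le _ _ p0 (ltW t0)))//.
    rewrite exponential_pdfE; last exact: ltW.
    rewrite /K (_ : - 2^-1 * t = - (t / 2)); last by ring.
    by rewrite le_eqVlt; apply/orP; left; apply/eqP; field.
apply: (@le_lt_trans _ _
    (\int[lebesgue_measure]_t (K%:E * (exponential_pdf 2^-1 t)%:E)))%E.
  apply: ge0_subset_integral => //=; first exact: measurable_funeM.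
  by move=> t _; rewrite mule_ge0// lee_fin// exponential_pdf_ge0// ltW.
rewrite ge0_integralZl//; first by rewrite integral_exponential_pdf// mule1 ltry.
by move=> t _; rewrite lee_fin exponential_pdf_ge0// ltW.
Qed.

(** Monotone convergence along compact intervals that avoid 0, where powers may fail to be
    differentiable. Starting from 2 keeps the first interval nondegenerate. *)
Lemma cvg_integral_itv0y {R : realType} (f : R -> R) :
  measurable_fun setT f -> (forall t, 0 <= f t) ->
  (\int[lebesgue_measure]_(t in `[n.+2%:R^-1%R, n.+2%:R%R]) (f t)%:E
     @[n --> \oo] --> \int[lebesgue_measure]_(t in `]0%R, +oo[) (f t)%:E)%E.
Proof.
move=> mf f0.
have -> : `]0%R, +oo[%classic =
    \bigcup_n (`[n.+2%:R^-1, n.+2%:R]%classic : set R).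
  apply/seteqP; split => [x|x [n _]]/=; rewrite !in_itv/= ?andbT;
    [move=> x0|case/andP=> h _].
    exists (Num.truncn (Num.max x x^-1)) => //=.
    have : Num.max x x^-1 < (Num.truncn (Num.max x x^-1)).+2%:R.
      by rewrite (lt_trans (truncnS_gt _))// ltr_nat.
    rewrite gt_max => /andP[/ltW h1 /ltW h2].
    by rewrite in_itv/= h1 andbT invf_ple ?posrE.
  by rewrite (lt_le_trans _ h)// invr_gt0.
apply: ge0_nondecreasing_set_cvg_integral => //.
- move=> m n mn; rewrite subsetEset => x/=; rewrite !in_itv/= => /andP[h1 h2].
  rewrite (le_trans _ h1) ?lef_pV2 ?posrE ?ler_nat//=.
  by rewrite (le_trans h2)// ler_nat.
- by move=> n; apply/measurable_EFinP/measurable_funTS.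
- by move=> n x _; rewrite lee_fin.
Qed.

(** Integration by parts on compact intervals, with boundary terms tending to 0. The identity lives
    in the extended reals, so that finiteness of the right-hand integral can be deduced from it. *)
Lemma integral_gamma_integrandD1 {R : realType} (p : R) : 0 < p ->
  (\int[lebesgue_measure]_(t in `]0%R, +oo[) (gamma_integrand p t)%:E =
   p%:E * \int[lebesgue_measure]_(t in `]0%R, +oo[) (gamma_integrand (p - 1) t)%:E)%E.
Proof.
move=> p0.
have mg (q : R) : measurable_fun setT (gamma_integrand q).
  by apply/measurable_EFinP; exact: measurable_gamma_integrand.
rewrite -ge0_integralZl//=; last 3 first.
  exact: measurable_gamma_integrand.
  by move=> t _; rewrite lee_fin gamma_integrand_ge0.
  by rewrite lee_fin ltW.
have cv0 := cvg_integral_itv0y _ (mg p) (gamma_integrand_ge0 p).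
have cv1 := cvg_integral_itv0y (fun t => p * gamma_integrand (p - 1) t)
  (measurable_funM (measurable_cst p) (mg (p - 1)))
  (fun t => mulr_ge0 (ltW p0) (gamma_integrand_ge0 (p - 1) t)).
(* The boundary term for the antiderivative -exp(-t) of exp(-t), whose sign swaps the two ends. *)
pose r (n : nat) : R := gamma_integrand p n.+2%:R^-1 - gamma_integrand p n.+2%:R.
have rE n : (\int[lebesgue_measure]_(t in `[n.+2%:R^-1%R, n.+2%:R%R])
    (gamma_integrand p t)%:E = (r n)%:E +
    \int[lebesgue_measure]_(t in `[n.+2%:R^-1%R, n.+2%:R%R])
    (p * gamma_integrand (p - 1) t)%:E)%E.
  have n0 : 0 < n.+2%:R^-1 :> R by rewrite invr_gt0.
  have expN (x : R) : is_derive x 1 (fun t : R => - expR (- t)) (expR (- x)).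
    by apply: is_derive_eq; rewrite /GRing.scale/=; ring.
  have cexpN (x : R) : {for x, continuous (fun t : R => - expR (- t))}.
    apply: derivable1_continuous.
    by have := expN x => ?; exact: ex_derive.
  have cpow q (x : R) : 0 < x -> {for x, continuous (fun t : R => t `^ q)}.
    move=> x0; apply: derivable1_continuous.
    by have := is_derive1_powR q x0 => ?; exact: ex_derive.
  rewrite (@integration_by_parts R (fun t => t `^ p) (fun t => - expR (- t))
     (fun t => p * t `^ (p - 1)) (fun t => expR (- t))).
  - congr (_%:E + _)%E.
      by rewrite /r /gamma_integrand; ring.
    under eq_integral do rewrite mulrN EFinN -mulrA.
    rewrite integral_ge0N ?oppeK// => t _.
    by rewrite lee_fin mulr_ge0 ?gamma_integrand_ge0// ltW.
  - by rewrite (@lt_trans _ _ 1) ?invf_lt1 ?ltr1n.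
  - apply: continuous_in_subspaceT => x; rewrite inE/= in_itv/= => /andP[nx _].
    by apply: cvgMr; apply: cpow; exact: lt_le_trans nx.
  - split.
    + move=> x; rewrite in_itv/= => /andP[nx _].
      by have := is_derive1_powR p (lt_trans n0 nx) => ?; exact: ex_derive.
    + exact/cvg_at_right_filter/cpow.
    + by apply/cvg_at_left_filter/cpow.
  - move=> x; rewrite in_itv/= => /andP[nx _].
    rewrite derive1E; have := is_derive1_powR p (lt_trans n0 nx) => ?.
    exact: derive_val.
  - apply: continuous_subspaceT => x.
    apply: continuous_comp; first exact: continuousN.
    exact: continuous_expR.
  - split.
    + by move=> x _; have := expN x => ?; exact: ex_derive.
    + exact/cvg_at_right_filter/cexpN.
    + exact/cvg_at_left_filter/cexpN.
  - by move=> x _; rewrite derive1E; have := expN x => ?; exact: derive_val.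
have h0 : (n.+2%:R^-1 : R) @[n --> \oo] --> 0.
  by have /= -> := cvg_shiftS (@harmonic R) (nbhs (0 : R)); exact: cvg_harmonic.
have r0 : r n @[n --> \oo] --> 0.
  rewrite -[X in _ --> X](subr0 0); apply: cvgB.
    apply: (@squeeze_cvgr _ _ _ _ (fun=> 0) (fun n => n.+2%:R^-1 `^ p)).
    - apply: nearW => n.
      by rewrite gamma_integrand_ge0/= ler_piMr ?powR_ge0// expR_le1 oppr_le0.
    - exact: cvg_cst.
    - by have /cvg_at_rightP := powR_cvg0 p0; apply; split.
  (* At the upper end t = n + 2, half of the exponential absorbs the power and exp(-t / 2) <= 2 /
     t. *)
  apply: (@squeeze_cvgr _ _ _ _ (fun=> 0)
    (fun n => (2 * p) `^ p * (2 * n.+2%:R^-1))).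
  - apply: nearW => n; rewrite gamma_integrand_ge0/=.
    rewrite (le_trans (gamma_integrand_le _ _ p0 _))// ler_wpM2l ?powR_ge0//.
    rewrite expRN -[leRHS]invrK lef_pV2 ?posrE ?expR_gt0 ?invr_gt0 ?mulr_gt0//.
    by rewrite invfM invrK mulrC (le_trans _ (expR_ge1Dx _))// lerDr.
  - exact: cvg_cst.
  - rewrite [X in _ --> X](_ : 0 = (2 * p) `^ p * (2 * 0)); last by rewrite !mulr0.
    by do 2 apply: cvgMr.
move: cv0; under eq_fun do rewrite rE; move=> cv0.
have r0E : (r n)%:E @[n --> \oo] --> 0%E.
  by apply: cvg_EFin => //; exact: nearW.
have := cvgeD _ r0E cv1; rewrite add0e => cv2.
by apply: cvg_unique cv0 _ => //; apply: cv2; exact: fin_num_adde_defr.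
Qed.

Lemma GammaD1 {R : realType} (p : R) : 0 < p -> Gamma (p + 1) = p * Gamma p.
Proof.
move=> p0; rewrite /Gamma /Rintegral addrK.
have := integral_gamma_integrandD1 p p0.
have := integral_gamma_integrand_lty p p0; rewrite /gamma_integrand => + pE.
rewrite pE => fin; rewrite fineM// ge0_fin_numE; last first.
  by apply: integral_ge0 => t _; rewrite lee_fin gamma_integrand_ge0.
(* An infinite integral for p - 1 would remain infinite after multiplication by p > 0, against the
   finiteness for p. *)
rewrite ltey; apply: contraTN fin => /eqP ->.
by rewrite gt0_muley.
Qed.

(** On [1, 2] the integrand is at least exp(-2). *)
Lemma GammaD1_gt0 {R : realType} (p : R) : 0 < p -> 0 < Gamma (p + 1).
Proof.
move=> p0; rewrite /Gamma /Rintegral addrK fine_gt0//.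
have := integral_gamma_integrand_lty p p0; rewrite /gamma_integrand => ->.
rewrite andbT.
apply: (@lt_le_trans _ _ (\int[lebesgue_measure]_(t in `[1%R, 2%R]) (expR (- 2))%:E)%E).
  rewrite integral_cst//= lebesgue_measure_itv/= lte_fin ltr1n/=.
  by rewrite -EFinD -EFinM lte_fin mulr_gt0 ?expR_gt0//; lra.
apply: (@le_trans _ _ (\int[lebesgue_measure]_(t in `[1%R, 2%R])
    (gamma_integrand p t)%:E)%E).
  apply: ge0_le_integral => //=.
  - exact: measurable_gamma_integrand.
  - move=> t; rewrite in_itv/= => /andP[t1 t2]; rewrite lee_fin.
    rewrite /gamma_integrand -[leLHS]mul1r ler_pM ?expR_ge0//.
      have <- : 1 `^ p = 1 :> R by rewrite powR1.
      by rewrite ge0_ler_powR ?nnegrE ?(ltW p0)// (le_trans ler01).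
    by rewrite ler_expR lerN2.
apply: ge0_subset_integral => //=.
- exact: measurable_gamma_integrand.
- by move=> t _; rewrite lee_fin gamma_integrand_ge0.
- by move=> t/=; rewrite !in_itv/= andbT => /andP[t1 _]; exact: lt_le_trans t1.
Qed.

(** * Weighted averages and the Kantorovich nodes *)

(** The difference is the integral of w (h - v). The weight is not normalised, so its mass appears
    on both sides. *)
Lemma le_dist_weighted_Rintegral (d : measure_display) (T : measurableType d)
    {R : realType} (mu : {measure set T -> \bar R}) (D : set T)
    (w h : T -> R) (v c : R) :
  measurable D -> mu.-integrable D (EFin \o w) -> (forall t, D t -> 0 <= w t) ->
  measurable_fun D h -> (forall t, D t -> `|h t - v| <= c) ->
  `|\int[mu]_(t in D) (w t * h t) - (\int[mu]_(t in D) w t) * v|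
    <= (\int[mu]_(t in D) w t) * c.
Proof.
move=> mD iw w0 mh hv.
have [mw _] := integrableP _ _ _ iw; move/measurable_EFinP in mw.
have iwc : mu.-integrable D (EFin \o (fun t => w t * c)).
  by rewrite (_ : _ \o _ = fun t => (w t)%:E * c%:E)%E//; exact: integrableZr.
have iwv : mu.-integrable D (EFin \o (fun t => w t * v)).
  by rewrite (_ : _ \o _ = fun t => (w t)%:E * v%:E)%E//; exact: integrableZr.
have le_wc t : D t -> `|w t * (h t - v)| <= w t * c.
  by move=> Dt; rewrite normrM ger0_norm ?w0// ler_wpM2l ?w0 ?hv.
have iwk : mu.-integrable D (EFin \o (fun t => w t * (h t - v))).
  apply: le_integrable iwc => //.
    by apply/measurable_EFinP/measurable_funM => //; exact: measurable_funB.
  by move=> t Dt /=; rewrite lee_fin (le_trans (le_wc _ Dt))// ler_norm.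
have -> : \int[mu]_(t in D) (w t * h t) =
    \int[mu]_(t in D) (w t * (h t - v)) + \int[mu]_(t in D) (w t * v).
  by rewrite -RintegralD//; apply: eq_Rintegral => t _; ring.
rewrite RintegralZr// addrK (le_trans (le_normr_Rintegral _ _))//.
rewrite -RintegralZr//; apply: le_Rintegral => //.
by apply: integrable_norm iwk.
Qed.

Lemma kantorovich_node_in {R : realType} (gamma t : R) (j m : nat) :
  (j <= m)%N -> 0 < gamma -> 0 <= t <= 1 ->
  0 <= (j%:R + t `^ gamma) / (m%:R + 1) <= 1.
Proof.
move=> jm g0 /andP[t0 t1].
rewrite divr_ge0 ?addr_ge0 ?powR_ge0//= ler_pdivrMr ?mul1r; last first.
  by rewrite natr1 ltr0n.
rewrite lerD ?ler_nat//; have <- : 1 `^ gamma = 1 :> R by rewrite powR1.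
by rewrite ge0_ler_powR ?nnegrE// ltW.
Qed.

(** With u = t^gamma, the deviation is ((j - m z) + (u - z)) / (m + 1), where |u - z| <= 1; then (a
    + b)^2 <= 2 a^2 + 2 b^2. *)
Lemma kantorovich_node_sqr_le {R : realType} (gamma t z : R) (j m : nat) :
  0 < gamma -> 0 <= t <= 1 -> 0 <= z <= 1 ->
  ((j%:R + t `^ gamma) / (m%:R + 1) - z) ^+ 2 <=
  (2 * (j%:R - m%:R * z) ^+ 2 + 2) / (m%:R + 1) ^+ 2.
Proof.
move=> g0 t01 /andP[z0 z1].
have := kantorovich_node_in gamma t 0 0 isT g0 t01.
rewrite !add0r divr1 => /andP[]; move: (t `^ gamma) => u u0 u1.
have m0 : m%:R + 1 != 0 :> R by rewrite natr1 pnatr_eq0.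
have -> : (j%:R + u) / (m%:R + 1) - z =
    ((j%:R - m%:R * z) + (u - z)) / (m%:R + 1) by field.
rewrite expr_div_n ler_wpM2r ?invr_ge0 ?sqr_ge0//.
have : (u - z) ^+ 2 <= 1 by nra.
move: (_ - m%:R * z) (u - z) => a b b1.
have := sqr_ge0 (a - b); nra.
Qed.

(** * Uniform convergence of the operators *)

Theorem theorem2 (R : realType) (eta gamma alpha : R) (s : nat) (phi : R -> R)
    (eta_gt0 : 0 < eta) (gamma_gt0 : 0 < gamma)
    (alpha_ge0 : 0 <= alpha) (alpha_le1 : alpha <= 1)
    (phi_cont : {within `[0, 1], continuous phi}) :
  {uniform `[0, 1], (fun m : nat => frac_kantorovich eta gamma alpha s m phi)
                      @ \oo --> phi}.
Proof.
have a01 : 0 <= alpha <= 1 by rewrite alpha_ge0.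
have G1_gt0 := GammaD1_gt0 eta eta_gt0; have G1E := GammaD1 eta eta_gt0.
have G_gt0 : 0 < Gamma eta by move: G1_gt0; rewrite G1E pmulr_rgt0.
pose w (t : R) : R := (1 - t) `^ (eta - 1) / Gamma eta.
have w_ge0 t : 0 <= w t by rewrite divr_ge0 ?powR_ge0 ?ltW.
have iw0 := integrable_onem_powR eta eta_gt0.
have iw : lebesgue_measure.-integrable `[0, 1] (EFin \o w).
  by rewrite (_ : _ \o _ = fun t => ((1 - t) `^ (eta - 1))%:E * (Gamma eta)^-1%:E)%E//;
    exact: integrableZr.
pose W := \int[lebesgue_measure]_(t in `[0%R, 1%R]) w t.
(* Normalisation: W = 1 / (eta Gamma(eta)), so the total mass of the operator is 1. *)
have WE : Gamma (eta + 1) * W = 1.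
  rewrite /W RintegralZr// /Rintegral integral_onem_powR//= G1E; field.
  by rewrite !gt_eqF.
have mphi : measurable_fun (`[0, 1]%classic : set R) phi.
  exact: subspace_continuous_measurable_fun.
apply: cvg_uniform_norm => e e0.
have e20 : 0 < e / 2 by rewrite divr_gt0.
have [C C0 phiC] := continuous_le_sqr 0 1 phi (e / 2) phi_cont e20.
near=> m => z; rewrite /= in_itv/= => z01.
have sm : (s <= m)%N by near: m; exact: nbhs_infty_ge.
(* Bound for |phi(node) - phi(z)| that is uniform in t: the quadratic modulus of phi combined with
   the node estimate. *)
pose c j : R := e / 2 + C * ((2 * (j%:R - m%:R * z) ^+ 2 + 2) / (m%:R + 1) ^+ 2).
pose A j := \int[lebesgue_measure]_(t in `[0%R, 1%R])
  (w t * phi ((j%:R + t `^ gamma) / (m%:R + 1))).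
have q_ge0 j := qbasis_ge0 alpha s m j z a01 z01.
have Ac j : (j <= m)%N -> `|A j - W * phi z| <= W * c j.
  move=> jm; apply: le_dist_weighted_Rintegral => //.
  - apply: (@measurable_comp _ _ _ R R R `[0%R, 1%R] phi `[0%R, 1%R]
      (fun t => (j%:R + t `^ gamma) / (m%:R + 1))) => //.
      move=> _ /= [t + <-]; rewrite !in_itv/= => t01.
      exact: kantorovich_node_in.
    apply/measurable_funTS/measurable_funM => //.
    by apply: measurable_funD => //; exact: measurable_powR.
  - move=> t /=; rewrite in_itv/= => t01.
    have x01 := kantorovich_node_in gamma t j m jm gamma_gt0 t01.
    rewrite (le_trans (phiC _ _ _ _)) ?in_itv//= lerD2l ler_wpM2l//.
    exact: kantorovich_node_sqr_le.
(* Since the total mass is 1, phi(z) itself is an average and the error becomes an average of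
   differences. *)
have -> : phi z - frac_kantorovich eta gamma alpha s m phi z =
    Gamma (eta + 1) * \sum_(0 <= j < m.+1) qbasis alpha s m j z * (W * phi z - A j).
  under [in RHS]eq_bigr do rewrite mulrBr.
  rewrite sumrB mulrBr; congr (_ - _).
  by rewrite -mulr_suml sum_qbasis1// mul1r mulrA WE mul1r.
rewrite normrM gtr0_norm// (@le_trans _ _ (Gamma (eta + 1) *
    \sum_(0 <= j < m.+1) qbasis alpha s m j z * (W * c j)))//.
  rewrite ler_pM2l// (le_trans (ler_norm_sum _ _ _))// big_nat [leRHS]big_nat.
  apply: ler_sum => j /andP[_]; rewrite ltnS => jm.
  by rewrite normrM ger0_norm// ler_wpM2l// distrC Ac.
under eq_bigr do rewrite mulrCA.
rewrite -mulr_sumr mulrA WE mul1r.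
(* [k] is the coefficient of (j - m z)^2 in [c j], and also the contribution of the constant 2
   there. *)
pose k : R := C * (2 / (m%:R + 1) ^+ 2).
rewrite (_ : \sum_(_ <= _ < _) _ = (e / 2 + k) +
    k * \sum_(0 <= j < m.+1) qbasis alpha s m j z * (j%:R - m%:R * z) ^+ 2); last first.
  have <- : (e / 2 + k) * \sum_(0 <= j < m.+1) qbasis alpha s m j z = e / 2 + k.
    by rewrite sum_qbasis1// mulr1.
  rewrite !mulr_sumr -big_split/=; apply: eq_bigr => j _.
  by rewrite /c /k; ring.
have m1 : 0 < m%:R + 1 :> R by rewrite natr1 ltr0n.
have k0 : 0 <= k by rewrite mulr_ge0// divr_ge0// sqr_ge0.
rewrite -addrA [leRHS]splitr lerD2l.
rewrite (le_trans (lerD (lexx k) (ler_wpM2l k0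
  (sum_qbasis_sqr_le alpha s m z a01 z01 sm))))//.
(* Here k + k (m + s^2) <= k (1 + s^2) (m + 1) = 2 C (1 + s^2) / (m + 1), which is at most e / 2 for
   all large m, independently of z. *)
rewrite (@le_trans _ _ (k * ((1 + s%:R ^+ 2) * (m%:R + 1))))//.
  rewrite -[X in X + _]mulr1 -mulrDr ler_wpM2l//.
  have : 0 <= s%:R ^+ 2 * m%:R :> R by rewrite mulr_ge0.
  by rewrite mulrDr !mulrDl; lra.
rewrite (_ : _ * _ = (2 * C * (1 + s%:R ^+ 2)) / (m%:R + 1)); last first.
  by rewrite /k; field; rewrite gt_eqF.
rewrite ler_pdivrMr// -ler_pdivrMl//.
rewrite (@le_trans _ _ m%:R) ?lerDl//.
by near: m; exact: nbhs_infty_ger.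
Unshelve. all: by end_near. Qed.
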